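(* Let $k\ge 2$ and $q\ge 1$ be integers, let $\Omega_1,\dots,\Omega_k$ be finite sets with $|\Omega_i|=q$, and let $\mu$ be a pairwise independent probability distribution on $\Omega_1\times\cdots\times\Omega_k$ whose marginals $\mu_i$ satisfy $\mu_i(x)>0$ for all $x\in\Omega_i$. There is a constant $C$ depending only on $\mu$, which can be taken to be $C=\left(k\sqrt{\tfrac{q-1}{\alpha}}\right)^3$ with $\alpha=\min_i\alpha(\mu_i)$ (and, if all marginals $\mu_i$ are uniform, $C=(k\sqrt{q-1})^3$ for a suitable choice of complex Fourier bases), such that the following holds for every $n$ and every choice of Fourier bases of the spaces $L^2(\Omega_i,\mu_i)$. Let $f_i\in L^2(\Omega_i^n,\mu_i^{\otimes n})$ with $\|f_i\|_2\le 1$ for $i=1,\dots,k$, and let $D=\sum_{i=1}^k\deg(f_i)$. Then for all $\delta>0$, if $$\left|\langle f_1,\dots,f_k\rangle_\mu-\prod_{i=1}^k\mathbb{E}[f_i]\right|>C^D\delta,$$ then there exist a set $I\subseteq[k]$ with $|I|\ge 3$ and, for every $i\in I$, a non-zero multi-index $\sigma(i)\in\mathbb{Z}_q^n$ such that: (1) for all $i\in I$, $\ |\hat f_i(\sigma(i))|>\left(\dfrac{\delta}{2k}\right)^{2^k}$; (2) for all $a\in\bigcup_{i\in I}S(\sigma(i))$, $\ |\{i\in I: a\in S(\sigma(i))\}|\ge 3$. Moreover, if $\mu$ is $r$-wise independent (with $r\ge2$), then the $3$ in (2) may be replaced by $r+1$.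
   Context: Pairwise independence: for all $i<j$, $a\in\Omega_i$, $b\in\Omega_j$, $\Pr_{x\sim\mu}[x_i=a\wedge x_j=b]=\mu_i(a)\mu_j(b)$, where $\mu_i$ is the marginal of $\mu$ on $\Omega_i$. $r$-wise independence means that any at most $r$ of the coordinates of $x\sim\mu$ are mutually independent. $\alpha(\mu_i)$ is the minimum non-zero probability of an atom of $\mu_i$. $[k]=\{1,\dots,k\}$. $L^2(\Omega_i^n,\mu_i^{\otimes n})$ is the space of functions $\Omega_i^n\to\mathbb{C}$ with inner product $\langle f,g\rangle=\mathbb{E}[f\overline g]$ and norms $\|f\|_p=(\mathbb{E}|f|^p)^{1/p}$ under the product measure $\mu_i^{\otimes n}$; $\mathbb{E}[f_i]$ is the expectation under $\mu_i^{\otimes n}$. Fourier basis: an orthonormal basis $\chi^i_0,\dots,\chi^i_{q-1}$ of $L^2(\Omega_i,\mu_i)$ with $\chi^i_0\equiv 1$. For a multi-index $\sigma\in\mathbb{Z}_q^n$ put $\chi^i_\sigma(x_1,\dots,x_n)=\prod_{j=1}^n\chi^i_{\sigma_j}(x_j)$; these form an orthonormal basis of $L^2(\Omega_i^n,\mu_i^{\otimes n})$. The Fourier coefficients of $f\in L^2(\Omega_i^n,\mu_i^{\otimes n})$ are $\hat f(\sigma)=\langle f,\chi^i_\sigma\rangle$. The support of $\sigma$ is $S(\sigma)=\{j\in[n]:\sigma_j\ne 0\}$ and $|\sigma|=|S(\sigma)|$. The Fourier degree $\deg(f)$ is the infimum of all $d\in\mathbb{Z}$ such that $\hat f(\sigma)=0$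 whenever $|\sigma|>d$ (so $\deg(0)=-\infty$; conventions $C^{-\infty}=0$, $0^0=1$). Noisy inner product: $\langle f_1,\dots,f_k\rangle_\mu=\mathbb{E}_X\left[\prod_{i=1}^k f_i(X_i)\right]$, where $X$ is a random $k\times n$ matrix whose $n$ columns are i.i.d. samples from $\mu$, and $X_i\in\Omega_i^n$ is the $i$-th row of $X$. *)

(* Defs.v *)
From HB Require Import structures.
From mathcomp Require Import all_boot all_order all_algebra.
From mathcomp Require Import complex.
From mathcomp Require Import boolp classical_sets reals constructive_ereal ereal exp.

Set Implicit Arguments.
Unset Strict Implicit.
Unset Printing Implicit Defensive.

Import Order.TTheory GRing.Theory Num.Theory.
Local Open Scope ring_scope.
Local Open Scope complex_scope.

(* A point of Omega^n is a finite function 'I_n -> Omega, a point of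
   Omega_1 x ... x Omega_k is a dependent finite function over 'I_k, and a
   measure on a finite set is given by its real point masses.  Comparisons
   involving R[i] use its partial order, in which z <= w forces z and w to
   have the same imaginary part; they are only used on real quantities. *)

Section Distributions.
Variable R : realType.

Definition is_distribution (T : finType) (p : T -> R) : Prop :=
  (forall x, 0 <= p x) /\ \sum_x p x = 1.

Definition Pr (T : finType) (p : T -> R) (E : pred T) : R :=
  \sum_(x | E x) p x.

Definition Exp (T : finType) (p : T -> R) (f : T -> R[i]) : R[i] :=
  \sum_x (p x)%:C * f x.

Definition inner (T : finType) (p : T -> R) (f g : T -> R[i]) : R[i] :=
  Exp p (fun x => f x * (g x)^*%R).

Definition norm2 (T : finType) (p : T -> R) (f : T -> R[i]) : R[i] :=
  sqrtC (Exp p (fun x => `|f x| ^+ 2)).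

Definition iid (T : finType) (p : T -> R) (n : nat) (x : {ffun 'I_n -> T}) : R :=
  \prod_j p (x j).

(* The starting value 1 of the minimum is harmless: masses are at most 1. *)
Definition min_atom (T : finType) (p : T -> R) : R :=
  \big[Num.min/1]_(a | p a != 0) p a.

Definition uniform (T : finType) (p : T -> R) : Prop :=
  forall a, p a = (#|T|%:R)^-1.

End Distributions.

Section ProductSpace.
Variables (R : realType) (k : nat) (Omega : 'I_k -> finType).
Implicit Type mu : {dffun forall i, Omega i} -> R.

Definition marginal mu (i : 'I_k) (a : Omega i) : R :=
  Pr mu (fun x => x i == a).

Definition pairwise_independent mu : Prop :=
  forall i j : 'I_k, (i < j)%N -> forall (a : Omega i) (b : Omega j),
    Pr mu (fun x => (x i == a) && (x j == b)) = marginal mu a * marginal mu b.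

Definition rwise_independent (r : nat) mu : Prop :=
  forall J : {set 'I_k}, (#|J| <= r)%N -> forall a : {dffun forall i, Omega i},
    Pr mu (fun x => [forall i in J, x i == a i]) =
    \prod_(i in J) marginal mu (a i).

(* alpha = min_i alpha(mu_i) *)
Definition alpha mu : R := \big[Num.min/1]_(i < k) min_atom (@marginal mu i).

(* <f_1, ..., f_k>_mu: X ranges over n-tuples of columns, its i-th row is
   j |-> X j i. *)
Definition noisy_inner mu (n : nat)
    (f : forall i : 'I_k, {ffun 'I_n -> Omega i} -> R[i]) : R[i] :=
  Exp (@iid R _ mu n) (fun X => \prod_i f i [ffun j => X j i]).

End ProductSpace.

Section Fourier.
Variables (R : realType) (q : nat) (T : finType) (p : T -> R).

(* Z_q is 'I_q, its zero being the element of value 0; this avoids 'Z_q,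
   which is not Z/q for q = 1. *)
Definition is_fourier_basis (chi : 'I_q -> T -> R[i]) : Prop :=
  [/\ forall s : 'I_q, (s : nat) = 0%N -> forall x, chi s x = 1,
      forall s t : 'I_q, inner p (chi s) (chi t) = (s == t)%:R &
      forall f : T -> R[i], exists c : 'I_q -> R[i],
        forall x, f x = \sum_s c s * chi s x].

Definition tensor_chi (chi : 'I_q -> T -> R[i]) (n : nat)
    (sigma : {ffun 'I_n -> 'I_q}) (x : {ffun 'I_n -> T}) : R[i] :=
  \prod_j chi (sigma j) (x j).

Definition supp (n : nat) (sigma : {ffun 'I_n -> 'I_q}) : {set 'I_n} :=
  [set j | (sigma j : nat) != 0%N]%SET.

Definition fhat (chi : 'I_q -> T -> R[i]) (n : nat)
    (f : {ffun 'I_n -> T} -> R[i]) (sigma : {ffun 'I_n -> 'I_q}) : R[i] :=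
  inner (@iid R _ p n) f (tensor_chi chi sigma).

(* The infimum is taken in the extended reals, so that deg 0 = -oo. *)
Definition fdeg (chi : 'I_q -> T -> R[i]) (n : nat)
    (f : {ffun 'I_n -> T} -> R[i]) : \bar R :=
  ereal_inf [set (d%:~R)%:E | d in
    [set d : int | forall sigma : {ffun 'I_n -> 'I_q},
       d < #|supp sigma|%:Z -> fhat chi f sigma = 0]]%classic.

End Fourier.

(* C^D with C^(-oo) = 0 and 0^0 = 1 (the latter holds for powR).  The value at
   +oo is junk: a Fourier degree is never +oo, being at most n. *)
Definition pow_deg (R : realType) (C : R) (D : \bar R) : R :=
  if D is r%:E then powR C r else 0.

Section Conclusion.
Variables (R : realType) (k q : nat) (Omega : 'I_k -> finType).
Variables (mu : {dffun forall i, Omega i} -> R).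
Variables (chi : forall i : 'I_k, 'I_q -> Omega i -> R[i]).

(* The set I and the multi-indices sigma(i), i in I, with overlap m in (2);
   the values of sigma outside I are irrelevant. *)
Definition large_coefficients (m n : nat)
    (f : forall i : 'I_k, {ffun 'I_n -> Omega i} -> R[i]) (delta : R) : Prop :=
  exists (I : {set 'I_k}) (sigma : 'I_k -> {ffun 'I_n -> 'I_q}),
  [/\ (3 <= #|I|)%N,
      forall i, i \in I -> exists j, (sigma i j : nat) != 0%N,
      forall i, i \in I ->
        ((delta / (2 * k%:R)) ^+ (2 ^ k)%N)%:C <
          `|fhat (@marginal R k Omega mu i) (@chi i) (f i) (sigma i)| &
      forall a : 'I_n, a \in (\bigcup_(i in I) supp (sigma i))%SET ->
        (m <= #|[set i in I | a \in supp (sigma i)]%SET|)%N].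

Definition inverse_theorem (C : R) : Prop :=
  forall (n : nat) (f : forall i : 'I_k, {ffun 'I_n -> Omega i} -> R[i]),
  (forall i, norm2 (@iid R _ (@marginal R k Omega mu i) n) (f i) <= 1) ->
  let D := (\sum_(i < k) fdeg (@marginal R k Omega mu i) (@chi i) (f i))%E in
  forall delta : R, 0 < delta ->
  (pow_deg C D * delta)%:C <
    `|noisy_inner mu f
      - \prod_(i < k) Exp (@iid R _ (@marginal R k Omega mu i) n) (f i)| ->
  large_coefficients 3 f delta /\
  (forall r : nat, (2 <= r)%N -> rwise_independent r mu ->
     large_coefficients r.+1 f delta).

End Conclusion.

(* Main.v *)
(** Expanding every f_i in the tensor basis writes the noisy inner product as a
    sum over matrices S of multi-indices (rows S^i, columns S_j) of
    prod_i fhat_i(S^i) * prod_j E[prod_i chi^i_(S_j i)], whose S = 0 term is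
    prod_i E[f_i].  A non-zero column with at most r non-zero entries has zero
    moment, so the rows of a surviving S <> 0 would do as the sigma(i), unless
    some row i0 has a coefficient of size at most eps^(2^k), eps = delta / 2k.

    That coefficient is also at most 1, hence at most eps.  Bound it by eps, and
    put C^(-|S_j|) into the j-th column factor, which costs C^D in total.  What
    remains is, for each i0, the sum over S of prod_j K(S_j), where K(s) is
    C^(-|s|) times the absolute moment of the column s, against the coefficients
    of the f_i with i <> i0.  It is at most prod_(i <> i0) ||f_i||_2 <= 1 because
    this inequality holds for one column and tensorizes.  For one column: if
    a column s has at least two non-zero entries away from i0, Cauchy-Schwarz
    gives prod_i a_i(0) + prod_i a_i(s_i) <= prod_i ||a_i||_2, and the weights
    K(s), s <> 0, sum to at most 1 when C = (k sqrt(q-1) B)^3 with B >= |chi|.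
    So the difference is at most k C^D eps = C^D delta / 2. *)
Require Import Defs.
From HB Require Import structures.
From mathcomp Require Import all_boot all_order all_algebra.
From mathcomp Require Import all_field all_solvable.
From mathcomp Require Import complex boolp reals constructive_ereal ereal exp.
From mathcomp Require Import ring lra.

Set Implicit Arguments.
Unset Strict Implicit.
Unset Printing Implicit Defensive.

Import Order.TTheory GRing.Theory Num.Theory.
Local Open Scope ring_scope.
Local Open Scope complex_scope.

(** * The one-column inequality and its tensorization *)

Section Multilinear.
Variables (R : rcfType) (I Q : finType).

Definition ell2 (T : finType) (a : T -> R) : R := Num.sqrt (\sum_x a x ^+ 2).

Lemma ell2_ge0 (T : finType) (a : T -> R) : 0 <= ell2 a.
Proof. exact: sqrtr_ge0. Qed.

Lemma sqr_ell2 (T : finType) (a : T -> R) : ell2 a ^+ 2 = \sum_x a x ^+ 2.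
Proof. by rewrite sqr_sqrtr// sumr_ge0// => x _; apply: sqr_ge0. Qed.

Lemma le_ell2 (T : finType) (a : T -> R) (x : T) : a x <= ell2 a.
Proof.
rewrite (le_trans (ler_norm _))// -sqrtr_sqr ler_wsqrtr//.
by rewrite (bigD1 x)//= lerDl sumr_ge0// => y _; apply: sqr_ge0.
Qed.

Lemma cauchy_schwarz2 (a b c d : R) :
  a * c + b * d <= Num.sqrt (a ^+ 2 + b ^+ 2) * Num.sqrt (c ^+ 2 + d ^+ 2).
Proof.
rewrite -sqrtrM ?addr_ge0 ?sqr_ge0// (le_trans (ler_norm _))// -sqrtr_sqr.
rewrite ler_wsqrtr// -subr_ge0.
suff -> : (a ^+ 2 + b ^+ 2) * (c ^+ 2 + d ^+ 2) - (a * c + b * d) ^+ 2 =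
  (a * d - b * c) ^+ 2 by apply: sqr_ge0.
rewrite !expr2; ring.
Qed.

Lemma sqrt2_le_ell2 (T : finType) (a : T -> R) (x y : T) : x != y ->
  Num.sqrt (a x ^+ 2 + a y ^+ 2) <= ell2 a.
Proof.
move=> xy; rewrite ler_wsqrtr// (bigD1 x)//= lerD2l (bigD1 y) 1?eq_sym//=.
by rewrite lerDl sumr_ge0// => t _; apply: sqr_ge0.
Qed.

(** All factors except those at [i] and [j] are bounded by their [ell2] norms. What is left is
    two-term Cauchy-Schwarz: since [s] and [t] differ at both places, it involves two distinct
    entries of [a i] and two of [a j]. *)
Lemma prod_add_le_ell2 (P : pred I) (a : I -> Q -> R) (s t : I -> Q) (i j : I) :
  (forall i x, 0 <= a i x) -> P i -> P j -> i != j -> s i != t i -> s j != t j ->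
  \prod_(l | P l) a l (s l) + \prod_(l | P l) a l (t l) <=
  \prod_(l | P l) ell2 (a l).
Proof.
move=> a0 Pi Pj ij si sj.
have split2 F : \prod_(l | P l) F l =
    F i * F j * \prod_(l | P l && (l != i) && (l != j)) F l :> R.
  by rewrite (bigD1 i)//= (bigD1 j)/= ?mulrA ?Pj 1?eq_sym.
rewrite !split2.
set r := (X in _ <= _ * X).
have le_r (u : I -> Q) :
    \prod_(l | P l && (l != i) && (l != j)) a l (u l) <= r.
  by apply: ler_prod => l _; rewrite a0 le_ell2.
apply: (@le_trans _ _ ((a i (s i) * a j (s j) + a i (t i) * a j (t j)) * r)).
  by rewrite mulrDl lerD// ler_wpM2l// mulr_ge0.
apply: ler_wpM2r; first by apply: prodr_ge0 => l _; exact: ell2_ge0.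
apply: (le_trans (cauchy_schwarz2 _ _ _ _)).
by rewrite ler_pM ?sqrtr_ge0 ?sqrt2_le_ell2.
Qed.

(** With [N] the right-hand side and [x0] the product at [s0], each other product of non-zero weight
    is at most [N - x0]. Those weights have total mass at most 1, so together with [x0] they give at
    most [N]. *)
Lemma column_bound (P : pred I) (K : {ffun I -> Q} -> R) (s0 : {ffun I -> Q})
    (a : I -> Q -> R) :
  (forall s, 0 <= K s) -> K s0 = 1 -> \sum_(s | s != s0) K s <= 1 ->
  (forall s, s != s0 -> K s != 0 -> exists i j,
     [/\ P i, P j, i != j, s0 i != s i & s0 j != s j]) ->
  (forall i x, 0 <= a i x) ->
  \sum_s K s * \prod_(i | P i) a i (s i) <= \prod_(i | P i) ell2 (a i).
Proof.
move=> K0 Ks0 Kle Ksupp a0.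
set N := (X in _ <= X).
set x0 := \prod_(i | P i) a i (s0 i).
have x0N : x0 <= N by apply: ler_prod => i _; rewrite a0 le_ell2.
rewrite (bigD1 s0)//= Ks0 mul1r -/x0 -lerBrDl.
apply: (@le_trans _ _ ((\sum_(s | s != s0) K s) * (N - x0))); last first.
  by apply: ler_piMl => //; rewrite subr_ge0.
rewrite mulr_suml; apply: ler_sum => s ss0.
have [->|Ks] := eqVneq (K s) 0; first by rewrite !mul0r.
apply: ler_wpM2l => //; rewrite lerBrDl.
have [i [j [Pi Pj ij si sj]]] := Ksupp s ss0 Ks.
exact: (prod_add_le_ell2 a0 Pi Pj ij si sj).
Qed.

Definition fcons (T : Type) (n : nat) (x : T) (g : {ffun 'I_n -> T}) :
    {ffun 'I_n.+1 -> T} :=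
  [ffun j => if unlift ord0 j is Some j' then g j' else x].

Lemma fcons0 (T : Type) (n : nat) (x : T) (g : {ffun 'I_n -> T}) :
  fcons x g ord0 = x.
Proof. by rewrite ffunE unlift_none. Qed.

Lemma fconsS (T : Type) (n : nat) (x : T) (g : {ffun 'I_n -> T}) (j : 'I_n) :
  fcons x g (lift ord0 j) = g j.
Proof. by rewrite ffunE liftK. Qed.

Lemma sum_fcons (T : finType) (n : nat) (F : {ffun 'I_n.+1 -> T} -> R) :
  \sum_g F g = \sum_x \sum_g F (fcons x g).
Proof.
rewrite pair_big/= (reindex (fun p : T * {ffun 'I_n -> T} => fcons p.1 p.2))//=.
exists (fun g : {ffun 'I_n.+1 -> T} => (g ord0, [ffun j => g (lift ord0 j)])).
  case=> x g _ /=; rewrite fcons0; congr (_, _).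
  by apply/ffunP => j; rewrite ffunE fconsS.
move=> g _; apply/ffunP => j; rewrite ffunE /=.
by case: unliftP => [j'|] ->; rewrite ?ffunE.
Qed.

(** Induction on the number of columns. With the first column [s] fixed, the induction hypothesis
    bounds the remaining sum by the product of the slice norms [b i (s i)]. The one-column
    inequality then applies to [b], and the [ell2] norm of the slice norms is the norm of the whole
    function. *)
Lemma tensor_bound (P : pred I) (K : {ffun I -> Q} -> R) :
  (forall s, 0 <= K s) ->
  (forall a : I -> Q -> R, (forall i x, 0 <= a i x) ->
     \sum_s K s * \prod_(i | P i) a i (s i) <= \prod_(i | P i) ell2 (a i)) ->
  forall n (a : I -> {ffun 'I_n -> Q} -> R), (forall i x, 0 <= a i x) ->
  \sum_(S : {ffun 'I_n -> {ffun I -> Q}})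
     (\prod_j K (S j)) * \prod_(i | P i) a i [ffun j => S j i] <=
  \prod_(i | P i) ell2 (a i).
Proof.
move=> K0 Kcol; elim=> [|n IH] a a0.
  rewrite (big_pred1 (ffun0 (card_ord 0))) => [|S].
    rewrite big_ord0 mul1r; apply: ler_prod => i _.
    by rewrite a0 le_ell2.
  by apply/esym/eqP/ffunP; case.
rewrite sum_fcons.
pose b i x := ell2 (fun g => a i (fcons x g)).
apply: (@le_trans _ _ (\sum_s K s * \prod_(i | P i) b i (s i))).
  apply: ler_sum => s _.
  have E (S : {ffun 'I_n -> {ffun I -> Q}}) :
      (\prod_j K (fcons s S j)) *
        \prod_(i | P i) a i [ffun j => fcons s S j i] =
      K s * ((\prod_j K (S j)) *
        \prod_(i | P i) a i (fcons (s i) [ffun j => S j i])).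
    rewrite big_ord_recl fcons0 -mulrA; congr (_ * (_ * _)).
      by apply: eq_bigr => j _; rewrite fconsS.
    apply: eq_bigr => i _; congr (a i _); apply/ffunP => j.
    by rewrite !ffunE; case: unliftP => [j'|] _; rewrite ?ffunE.
  rewrite (eq_bigr _ (fun S _ => E S)).
  rewrite -mulr_sumr; apply: ler_wpM2l => //.
  by apply: (IH (fun i g => a i (fcons (s i) g))).
apply: (le_trans (Kcol b _)) => [i x|]; first exact: ell2_ge0.
apply: ler_prod => i _; rewrite ell2_ge0 /=.
rewrite /ell2 sum_fcons ler_wsqrtr//.
by apply: ler_sum => x _; rewrite sqr_ell2.
Qed.

End Multilinear.

(** Distributivity when the index type varies with the factor. The inner sums are moved to tagged
    pairs, where distributivity for a single codomain applies, and the resulting families are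
    matched with dependent functions. *)
Lemma prod_sum_dffun (R : comPzSemiRingType) (I : finType) (T : I -> finType)
    (F : forall i, T i -> R) :
  \prod_i \sum_(a : T i) F i a =
  \sum_(x : {dffun forall i, T i}) \prod_i F i (x i).
Proof.
under eq_bigr do rewrite (big_tag F).
rewrite bigA_distr_big_dep.
rewrite (reindex _ (onW_bij _ (dffun_of_fprod_bij T))) /=.
under [RHS]eq_bigr => t _ do under eq_bigr => i _ do
  rewrite /dffun_of_fprod ffunE -[F i _](ffunE (F i)).
rewrite (big_fprod 1 +%R (fun i => [ffun a => F i a])).
apply: eq_bigr => g _; apply: eq_bigr => i _.
by rewrite /untag; case: eqP => // e; rewrite ffunE.
Qed.

(** * Orthonormal expansions, Parseval, and tensor Fourier bases *)

Section Orthonormal.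
Variables (R : realType) (S T : finType) (p : T -> R) (e : S -> T -> R[i]).
Hypothesis e_orth : forall s t, inner p (e s) (e t) = (s == t)%:R.

Lemma Exp_sum (I : finType) (c : I -> R[i]) (F : I -> T -> R[i]) :
  Exp p (fun x => \sum_i c i * F i x) = \sum_i c i * Exp p (F i).
Proof.
rewrite /Exp; under eq_bigr do rewrite mulr_sumr.
rewrite exchange_big; apply: eq_bigr => i _.
by rewrite mulr_sumr; apply: eq_bigr => x _; rewrite mulrCA.
Qed.

Lemma eq_Exp (f g : T -> R[i]) : f =1 g -> Exp p f = Exp p g.
Proof. by move=> fg; apply: eq_bigr => x _; rewrite fg. Qed.

Lemma coef_orthonormal (f : T -> R[i]) (c : S -> R[i]) :
  (forall x, f x = \sum_s c s * e s x) -> forall s, c s = inner p f (e s).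
Proof.
move=> fE s; rewrite /inner.
under eq_Exp do rewrite fE mulr_suml.
under eq_Exp do under eq_bigr do rewrite -mulrA.
rewrite Exp_sum (bigD1 s)//= big1 ?addr0.
  by rewrite -[Exp _ _]/(inner p (e s) (e s)) e_orth eqxx mulr1.
move=> t ts; rewrite -[Exp _ _]/(inner p (e t) (e s)) e_orth.
by rewrite (negPf ts) mulr0.
Qed.

Lemma parseval_orthonormal (f : T -> R[i]) :
  (forall x, f x = \sum_s inner p f (e s) * e s x) ->
  Exp p (fun x => `|f x| ^+ 2) = \sum_s `|inner p f (e s)| ^+ 2.
Proof.
move=> fE.
transitivity (Exp p (fun x => \sum_s (inner p f (e s))^*%R * (f x * (e s x)^*%R))).
  apply: eq_Exp => x; rewrite normCK {2}fE rmorph_sum mulr_sumr.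
  by apply: eq_bigr => s _; rewrite rmorphM mulrCA.
by rewrite Exp_sum; apply: eq_bigr => s _; rewrite normCKC.
Qed.

End Orthonormal.

Section FourierTensor.
Variables (R : realType) (q : nat) (T : finType) (p : T -> R).
Variables (chi : 'I_q -> T -> R[i]).
Hypothesis chi_basis : is_fourier_basis p chi.
Variable n : nat.

Lemma inner_tensor_chi (s t : {ffun 'I_n -> 'I_q}) :
  inner (@iid R T p n) (tensor_chi chi s) (tensor_chi chi t) = (s == t)%:R.
Proof.
have [_ orth _] := chi_basis.
transitivity (\prod_j inner p (chi (s j)) (chi (t j))).
  rewrite /inner /Exp bigA_distr_bigA; apply: eq_bigr => x _.
  by rewrite /iid /tensor_chi !rmorph_prod/= -!big_split.
under eq_bigr do rewrite orth.
have [->|st] := eqVneq s t; first by rewrite big1// => j _; rewrite eqxx.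
have [j /negPf sj] : exists j, s j != t j.
  by apply/existsP; rewrite -negb_forall; apply: contraNN st => /eqfunP/ffunP/eqP.
by rewrite (bigD1 j)//= sj mul0r.
Qed.

(** Spanning passes to the tensor power through point masses: the indicator of a point is a product
    of one-coordinate indicators, each of which expands in [chi]. Orthonormality then forces the
    coefficients to be the [fhat]. *)
Lemma fourier_expansion (f : {ffun 'I_n -> T} -> R[i]) (x : {ffun 'I_n -> T}) :
  f x = \sum_s fhat p chi f s * tensor_chi chi s x.
Proof.
have [_ orth span] := chi_basis.
pose d y s := inner p (fun z => (z == y)%:R) (chi s).
have dE (y z : T) : (z == y)%:R = \sum_s d y s * chi s z.
  have [c cE] := span (fun z => (z == y)%:R).
  by rewrite cE; apply: eq_bigr => s _; rewrite [c s](coef_orthonormal orth cE).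
(* The coefficient of [tensor_chi chi s] in the sum over [y] of [f y] times the indicator of [y]. *)
pose c (s : {ffun 'I_n -> 'I_q}) :=
  \sum_(y : {ffun 'I_n -> T}) f y * \prod_j d (y j) (s j).
have fE z : f z = \sum_s c s * tensor_chi chi s z.
  under eq_bigr do rewrite mulr_suml.
  rewrite exchange_big /= (bigD1 z)//= [X in _ + X]big1 ?addr0.
    rewrite -[LHS]mulr1.
    under eq_bigr do rewrite -mulrA -big_split.
    rewrite -mulr_sumr; congr (_ * _).
    rewrite -(bigA_distr_bigA (fun j s => d (z j) s * chi s (z j))).
    by rewrite big1// => j _; rewrite -dE eqxx.
  move=> y yz; under eq_bigr do rewrite -mulrA -big_split.
  rewrite -mulr_sumr.
  rewrite -(bigA_distr_bigA (fun j s => d (y j) s * chi s (z j))).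
  have [j /negPf zy] : exists j, z j != y j.
    apply/existsP; rewrite -negb_forall; apply: contraNN yz.
    by move=> /eqfunP/ffunP ->.
  by rewrite (bigD1 j)//= -dE zy mul0r mulr0.
rewrite {1}fE; apply: eq_bigr => s _.
by rewrite [c s](coef_orthonormal inner_tensor_chi fE).
Qed.

Lemma parseval (f : {ffun 'I_n -> T} -> R[i]) :
  Exp (@iid R T p n) (fun x => `|f x| ^+ 2) = \sum_s `|fhat p chi f s| ^+ 2.
Proof. exact: (parseval_orthonormal (fourier_expansion f)). Qed.

(** Moves Parseval from the complex-valued norm to the real [ell2], in which the tensorized bound is
    stated. *)
Lemma ell2_fhat_le1 (f : {ffun 'I_n -> T} -> R[i]) :
  norm2 (@iid R T p n) f <= 1 ->
  ell2 (fun s => Normc.normc (fhat p chi f s)) <= 1.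
Proof.
rewrite /norm2 parseval => f1.
have E : \sum_s `|fhat p chi f s| ^+ 2 =
    (ell2 (fun s => Normc.normc (fhat p chi f s)) ^+ 2)%:C.
  by rewrite sqr_ell2 rmorph_sum; apply: eq_bigr => s _; rewrite rmorphXn.
move: f1; rewrite E rmorphXn /= sqrCK.
  by rewrite -lecR.
by rewrite -[0]/(0%:C) lecR ell2_ge0.
Qed.

Lemma Exp_fhat0 (f : {ffun 'I_n -> T} -> R[i]) (z : {ffun 'I_n -> 'I_q}) :
  (forall j, (z j : nat) = 0%N) ->
  Exp (@iid R T p n) f = fhat p chi f z.
Proof.
have [chi0 _ _] := chi_basis.
move=> z0; apply: eq_Exp => x; rewrite /tensor_chi big1 ?rmorph1 ?mulr1//.
by move=> j _; rewrite chi0.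
Qed.

End FourierTensor.

Lemma Exp_iid_prod (R : realType) (T : finType) (p : T -> R) (n : nat)
    (G : 'I_n -> T -> R[i]) :
  Exp (@iid R T p n) (fun x => \prod_j G j (x j)) = \prod_j Exp p (G j).
Proof.
rewrite /Exp bigA_distr_bigA; apply: eq_bigr => x _.
by rewrite /iid rmorph_prod -big_split.
Qed.

(** * Independence and the moments of a single column *)

Section Independence.
Variables (R : realType) (k : nat) (Omega : 'I_k -> finType).
Variable mu : {dffun forall i, Omega i} -> R.
Hypothesis hmu : is_distribution mu.

Lemma sum_marginal (i : 'I_k) : \sum_(a : Omega i) marginal mu a = 1.
Proof.
rewrite -hmu.2 (partition_big (fun x : {dffun forall i, Omega i} => x i) xpredT)//=.
Qed.

Lemma Exp_prod_independent (J : {set 'I_k}) (g : forall i, Omega i -> R[i]) :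
  (forall a : {dffun forall i, Omega i},
     Pr mu (fun x => [forall i in J, x i == a i]) =
     \prod_(i in J) marginal mu (a i)) ->
  Exp mu (fun x => \prod_(i in J) g i (x i)) =
  \prod_(i in J) Exp (@marginal R k Omega mu i) (g i).
Proof.
move=> indep.
pose m i (b : Omega i) : R[i] := (marginal mu b)%:C.
pose agree (x a : {dffun forall i, Omega i}) := [forall i in J, x i == a i].
have sum_m i : \sum_b m i b = 1 by rewrite -rmorph_sum sum_marginal.
(* Independence speaks of full assignments [a], of which only the values on [J] matter. The weight
   [w] averages out the other coordinates, with total mass 1 over the [a] that agree with a given
   [x] on [J]. *)
pose w (a : {dffun forall i, Omega i}) := \prod_(i | i \notin J) m i (a i).
have sum_w x : \sum_(a | agree x a) w a = 1.
  transitivity (\prod_i \sum_(b : Omega i)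
      (if i \in J then (x i == b)%:R else m i b)).
    rewrite prod_sum_dffun big_mkcond; apply: eq_bigr => a _.
    case: ifP => [/forall_inP xa|/negbT].
      rewrite (bigID (mem J)) /= big1 ?mul1r => [|i iJ].
        by apply: eq_bigr => i /negPf ->.
      by rewrite iJ xa.
    by rewrite negb_forall_in => /exists_inP[i iJ /negPf xa];
       rewrite (bigD1 i)//= iJ xa mul0r.
  rewrite big1// => i _; case: (boolP (i \in J)) => [iJ|_]; last exact: sum_m.
  rewrite (bigD1 (x i))//= eqxx big1 ?addr0// => b.
  by rewrite eq_sym => /negPf ->.
transitivity (\sum_(a : {dffun forall i, Omega i})
    \prod_i (m i (a i) * (if i \in J then g i (a i) else 1))); last first.
  rewrite -(prod_sum_dffun (fun i b => m i b * (if i \in J then g i b else 1))).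
  rewrite (bigID (mem J)) /= [X in _ * X]big1 ?mulr1.
    by apply: eq_bigr => i ->.
  move=> i /negPf ->; rewrite -[RHS](sum_m i).
  by apply: eq_bigr => b _; rewrite mulr1.
(* Double counting of agreeing pairs: summing over [x] first produces the probability in [indep],
   summing over [a] first removes [w] and leaves the expectation under [mu]. *)
transitivity (\sum_(a : {dffun forall i, Omega i})
    \sum_(x | agree x a) w a * ((mu x)%:C * \prod_(i in J) g i (a i))); last first.
  apply: eq_bigr => a _; rewrite -mulr_sumr -mulr_suml -rmorph_sum.
  rewrite -[\sum_(x | _) _]/(Pr mu (fun x => agree x a)) indep rmorph_prod.
  rewrite big_split /= [in RHS](bigID (mem J)) /= [X in _ = _ * X](bigID (mem J)) /=.
  rewrite [X in _ = _ * (_ * X)]big1 ?mulr1 => [|i /negPf ->//].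
  rewrite mulrCA mulrA; congr (_ * _ * _); by apply: eq_bigr => i ->.
rewrite (exchange_big_dep xpredT)//=; apply: eq_bigr => x _.
rewrite -[LHS]mul1r -(sum_w x) mulr_suml; apply: eq_bigr => a /forall_inP xa.
congr (_ * (_ * _)); apply: eq_bigr => i iJ; congr (g i _).
by apply/eqP/xa.
Qed.

Lemma rwise_independent2 : pairwise_independent mu -> rwise_independent 2 mu.
Proof.
move=> hpair J; case EJ: #|J| => [|[|[|m]]] // _ a.
- move/eqP: EJ; rewrite cards_eq0 => /eqP ->; rewrite big_set0.
  rewrite -hmu.2; apply: eq_bigl => x.
  by apply/forall_inP => i; rewrite inE.
- move/eqP/cards1P: EJ => [i ->]; rewrite big_set1.
  apply: eq_bigl => x; apply/forall_inP/eqP => [xa|xi j]; first by apply/eqP/xa; rewrite set11.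
  by rewrite inE => /eqP ->; rewrite xi.
- move/eqP/cards2P: EJ => [i [j [ij ->]]].
  rewrite big_setU1 ?inE//= big_set1.
  have E (x : {dffun forall i, Omega i}) :
      [forall l in [set i; j], x l == a l] = (x i == a i) && (x j == a j).
    apply/forall_inP/andP => [xa|[xi xj] l]; first by split; apply: xa; rewrite !inE eqxx ?orbT.
    by rewrite !inE => /orP[]/eqP ->.
  rewrite /Pr (eq_bigl _ _ E).
  (* Pairwise independence is given for ordered pairs only, so the other order goes through
     symmetry. *)
  case: (ltngtP i j) ij => [lij _|lji _|/val_inj ->]; last by rewrite eqxx.
    exact: hpair.
  by rewrite mulrC -hpair//; apply: eq_bigl => x; rewrite andbC.
Qed.

Variables (q : nat) (chi : forall i : 'I_k, 'I_q -> Omega i -> R[i]).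
Hypothesis chi_basis :
  forall i, is_fourier_basis (@marginal R k Omega mu i) (@chi i).

Definition column_moment (s : {ffun 'I_k -> 'I_q}) : R[i] :=
  Exp mu (fun x => \prod_i chi (s i) (x i)).

Lemma noisy_inner_expansion (n : nat)
    (f : forall i : 'I_k, {ffun 'I_n -> Omega i} -> R[i]) :
  noisy_inner mu f = \sum_(S : {ffun 'I_n -> {ffun 'I_k -> 'I_q}})
    (\prod_i fhat (@marginal R k Omega mu i) (@chi i) (f i) [ffun j => S j i]) *
    \prod_j column_moment (S j).
Proof.
pose row (X : {ffun 'I_n -> {dffun forall i, Omega i}}) i := [ffun j => X j i].
pose c i s := fhat (@marginal R k Omega mu i) (@chi i) (f i) s.
transitivity (Exp (@iid R _ mu n) (fun X =>
    \sum_(S : {ffun 'I_n -> {ffun 'I_k -> 'I_q}})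
      (\prod_i c i [ffun j => S j i]) * \prod_j \prod_i chi (S j i) (X j i))).
  apply: eq_Exp => X.
  under eq_bigr do rewrite (fourier_expansion (chi_basis _) (f _)).
  rewrite (bigA_distr_bigA (fun i s => c i s * tensor_chi (@chi i) s (row X i))).
  (* Distributing over the rows yields one multi-index per row; transposition turns this family into
     a matrix listed by columns. *)
  rewrite (reindex (fun S : {ffun 'I_n -> {ffun 'I_k -> 'I_q}} =>
      [ffun i => [ffun j => S j i]])) /=; last first.
    exists (fun t : {ffun 'I_k -> {ffun 'I_n -> 'I_q}} => [ffun j => [ffun i => t i j]]).
      by move=> S _; apply/ffunP => j; rewrite ffunE; apply/ffunP => i; rewrite !ffunE.
    by move=> t _; apply/ffunP => i; rewrite ffunE; apply/ffunP => j; rewrite !ffunE.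
  apply: eq_bigr => S _; rewrite big_split /=; congr (_ * _).
    by apply: eq_bigr => i _; rewrite ffunE.
  rewrite exchange_big; apply: eq_bigr => i _ /=.
  by apply: eq_bigr => j _; rewrite !ffunE.
rewrite Exp_sum; apply: eq_bigr => S _; congr (_ * _).
by rewrite -(Exp_iid_prod mu (fun j (x : {dffun forall i, Omega i}) =>
  \prod_i chi (S j i) (x i))).
Qed.

Definition column_supp (s : {ffun 'I_k -> 'I_q}) : {set 'I_k} :=
  [set i | (s i : nat) != 0%N].

Lemma column_moment_supp (s : {ffun 'I_k -> 'I_q}) :
  column_moment s = Exp mu (fun x => \prod_(i in column_supp s) chi (s i) (x i)).
Proof.
apply: eq_Exp => x; rewrite (bigID (mem (column_supp s))) /= [X in _ * X]big1 ?mulr1//.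
move=> i; rewrite inE negbK => /eqP si.
by have [chi0 _ _] := chi_basis i; rewrite chi0.
Qed.

Lemma column_moment1 (s : {ffun 'I_k -> 'I_q}) :
  column_supp s = set0 -> column_moment s = 1.
Proof.
move=> s0; rewrite column_moment_supp s0 /Exp.
under eq_bigr do rewrite big_set0 mulr1.
by rewrite -rmorph_sum hmu.2.
Qed.

(** The moment factors into one-coordinate expectations. A factor with [s i] non-zero is the inner
    product of [chi (s i)] with the constant basis function, hence zero. *)
Lemma column_moment0 (r : nat) (s : {ffun 'I_k -> 'I_q}) :
  rwise_independent r mu -> (0 < #|column_supp s| <= r)%N ->
  column_moment s = 0.
Proof.
move=> hr /andP[s0 sr]; rewrite column_moment_supp.
rewrite (Exp_prod_independent (fun i => chi (s i)) (hr _ sr)).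
have /card_gt0P[i si] := s0; rewrite (bigD1 i)//=.
suff -> : Exp (@marginal R k Omega mu i) (chi (s i)) = 0 by rewrite mul0r.
have [chi0 orth _] := chi_basis i.
have q0 : (0 < q)%N by apply: leq_ltn_trans (ltn_ord (s i)).
pose z : 'I_q := Ordinal q0.
transitivity (inner (@marginal R k Omega mu i) (chi (s i)) (chi z)).
  by apply: eq_Exp => x; rewrite [chi z x]chi0// rmorph1 mulr1.
rewrite orth; case: eqVneq => // e.
by move: si; rewrite inE e.
Qed.

Lemma norm_column_moment_le (B : R) (s : {ffun 'I_k -> 'I_q}) :
  (forall i t x, Normc.normc (chi (i := i) t x) <= B) ->
  Normc.normc (column_moment s) <= B ^+ #|column_supp s|.
Proof.
move=> chiB; rewrite -lecR.
apply: (@le_trans _ _ (\sum_x `|(mu x)%:C * \prod_(i in column_supp s) chi (s i) (x i)|)).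
  rewrite column_moment_supp -[X in X <= _]/(`|Exp mu _|) /Exp.
  exact: ler_norm_sum.
apply: (@le_trans _ _ (\sum_x (mu x)%:C * (B ^+ #|column_supp s|)%:C)); last first.
  by rewrite -mulr_suml -rmorph_sum hmu.2 mul1r.
apply: ler_sum => x _; rewrite normrM ger0_norm; last by rewrite ler0c; apply: hmu.1.
apply: ler_wpM2l; first by rewrite ler0c; apply: hmu.1.
rewrite normr_prod -prodr_const rmorph_prod; apply: ler_prod => i _.
by rewrite normr_ge0 /= lecR.
Qed.

End Independence.

(** * Numerical estimates and bounds on the Fourier degree *)

Lemma normc_ge0 (R : rcfType) (z : R[i]) : 0 <= Normc.normc z.
Proof. rewrite -ler0c; exact: (normr_ge0 z). Qed.

Lemma normc_prod (R : rcfType) (I : finType) (F : I -> R[i]) :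
  Normc.normc (\prod_i F i) = \prod_i Normc.normc (F i).
Proof. exact: (big_morph _ (@Normc.normcM R) (Normc.normc1 R)). Qed.

(** The summand is a product over coordinates, and each coordinate contributes 1 for the value zero
    and [x] for each of the [q - 1] others. *)
Lemma sum_expr_column_supp (R : comPzRingType) (k q : nat) (x : R) :
  (0 < q)%N ->
  \sum_(s : {ffun 'I_k -> 'I_q}) x ^+ #|column_supp s| =
  (1 + (q%:R - 1) * x) ^+ k.
Proof.
move=> q0; pose z : 'I_q := Ordinal q0.
pose F (t : 'I_q) := if (t : nat) != 0%N then x else 1.
have sumF : \sum_t F t = 1 + (q%:R - 1) * x.
  rewrite (bigD1 z)//= {1}/F /=; congr (_ + _).
  rewrite (eq_bigr (fun=> x)) => [|t]; last first.
    by rewrite /F -val_eqE /= => ->.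
  by rewrite sumr_const cardC1 card_ord -[in RHS](prednK q0) -natr1 addrK mulr_natl.
transitivity (\sum_(s : {ffun 'I_k -> 'I_q}) \prod_i F (s i)).
  apply: eq_bigr => s _; rewrite -prodr_const [LHS]big_mkcond.
  by apply: eq_bigr => i _; rewrite inE.
rewrite -(bigA_distr_bigA (fun=> F)) (eq_bigr (fun=> 1 + (q%:R - 1) * x))//.
by rewrite prodr_const card_ord.
Qed.

Lemma expr1D_le2 (R : realFieldType) (k : nat) (y : R) :
  0 <= y -> k%:R * y <= 2^-1 -> (1 + y) ^+ k <= 2.
Proof.
move=> y0 ky.
(* A Bernoulli-type bound; at [m = k] the factor [1 - k y] is at least 1/2, which gives the constant
   2. *)
have bern m : m%:R * y <= 2^-1 -> (1 + y) ^+ m * (1 - m%:R * y) <= 1.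
  elim: m => [|m IH]; first by rewrite expr0 mul0r subr0 mulr1.
  move=> my; have my' : m%:R * y <= 2^-1.
    by apply: le_trans my; rewrite ler_wpM2r// ler_nat.
  apply: le_trans (IH my'); rewrite exprS mulrAC mulrC; apply: ler_wpM2l.
    by rewrite exprn_ge0// addr_ge0.
  rewrite -natr1; have : 0 <= m%:R * y * y by rewrite !mulr_ge0.
  have : 0 <= y * y by rewrite mulr_ge0.
  nra.
have := bern k ky; set p := (1 + y) ^+ k.
have : 0 <= p by rewrite exprn_ge0// addr_ge0.
move: ky; set w := k%:R * y => *; nra.
Qed.

Section Degree.
Variables (R : realType) (q : nat) (T : finType) (p : T -> R).
Variables (chi : 'I_q -> T -> R[i]) (n : nat).
Variable f : {ffun 'I_n -> T} -> R[i].

Lemma fdeg_ge (s : {ffun 'I_n -> 'I_q}) :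
  fhat p chi f s != 0 -> ((#|supp s|%:R)%:E <= fdeg p chi f)%E.
Proof.
move=> fs; apply: le_ereal_inf_tmp => _ [d dP <-].
rewrite lee_fin -[_%:R]/((#|supp s|%:Z)%:~R) ler_int leNgt.
by apply: contraNN fs => /dP ->.
Qed.

(** Keeps the sum of the degrees away from [+oo], where [pow_deg] has a junk value. *)
Lemma fdeg_le : (fdeg p chi f <= (n%:R)%:E)%E.
Proof.
apply: ereal_inf_lbound; exists n%:Z => //= s.
by rewrite ltz_nat ltnNge -[X in (_ <= X)%N](card_ord n) max_card.
Qed.

End Degree.

Lemma expr_le_pow_deg (R : realType) (C : R) (m : nat) (D : \bar R) :
  1 <= C -> ((m%:R)%:E <= D)%E -> (D < +oo)%E -> C ^+ m <= pow_deg C D.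
Proof.
case: D => [r| |]//= C1; rewrite lee_fin => mr _.
by rewrite -powR_mulrn ?ler_powR// (le_trans ler01).
Qed.

Lemma pow_deg_ge0 (R : realType) (C : R) (D : \bar R) : 0 <= pow_deg C D.
Proof. by case: D => //= r; apply: powR_ge0. Qed.

(** * The inverse theorem for bases bounded by [B] *)

Section Inverse.
Variables (R : realType) (k q : nat) (Omega : 'I_k -> finType).
Variable mu : {dffun forall i, Omega i} -> R.
Variables (chi : forall i : 'I_k, 'I_q -> Omega i -> R[i]) (B : R).
Hypothesis k2 : (2 <= k)%N.
Hypothesis q0 : (0 < q)%N.
Hypothesis hmu : is_distribution mu.
Hypothesis chi_basis :
  forall i, is_fourier_basis (@marginal R k Omega mu i) (@chi i).
Hypothesis B1 : 1 <= B.
Hypothesis chiB : forall i t x, Normc.normc (chi (i := i) t x) <= B.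
Let C : R := (k%:R * (Num.sqrt (q%:R - 1) * B)) ^+ 3.

(** For [q = 1] the constant [C] is 0 and so is its inverse; the convention [0 ^ 0 = 1] still gives
    the zero column weight 1. *)
Let kernel (s : {ffun 'I_k -> 'I_q}) : R :=
  Normc.normc (column_moment mu chi s) * C^-1 ^+ #|column_supp s|.

Lemma C_ge0 : 0 <= C.
Proof.
by rewrite exprn_ge0// !mulr_ge0 ?sqrtr_ge0 ?(le_trans ler01 B1)// ler0n.
Qed.

Lemma sqrt_q1_ge1 : (1 < q)%N -> 1 <= Num.sqrt (q%:R - 1 : R).
Proof.
by move=> q1; rewrite -[X in X <= _]sqrtr1 ler_wsqrtr// lerBrDl -[1 + 1]/(2%:R) ler_nat.
Qed.

Lemma C_ge1 : (1 < q)%N -> 1 <= C.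
Proof.
move=> q1; rewrite exprn_ege1// -[X in X <= _]mulr1 ler_pM// ?ler1n ?(ltnW k2)//.
by rewrite -[X in X <= _]mulr1 ler_pM// sqrt_q1_ge1.
Qed.

Lemma kernel_ge0 s : 0 <= kernel s.
Proof.
by rewrite mulr_ge0 ?exprn_ge0 ?invr_ge0 ?C_ge0 ?normc_ge0.
Qed.

(** Since a moment is at most [B] to the support size, the sum is at most
    [(1 + (q - 1) B / C) ^ k - 1]. The choice of [C] makes [k (q - 1) B / C] at most 1/2, so the
    power is at most 2. *)
Lemma sum_kernel_le1 (z : {ffun 'I_k -> 'I_q}) : column_supp z = set0 ->
  \sum_(s | s != z) kernel s <= 1.
Proof.
move=> z0.
have B0 : 0 <= B := le_trans ler01 B1.
have Ci0 : 0 <= C^-1 by rewrite invr_ge0 C_ge0.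
apply: (@le_trans _ _ (\sum_(s | s != z) (B * C^-1) ^+ #|column_supp s|)).
  apply: ler_sum => s _; rewrite exprMn ler_wpM2r ?exprn_ge0//.
  exact: (norm_column_moment_le hmu chi_basis s chiB).
have -> : \sum_(s | s != z) (B * C^-1) ^+ #|column_supp s| =
    (1 + (q%:R - 1) * (B * C^-1)) ^+ k - 1.
  rewrite -(sum_expr_column_supp _ _ q0) [in RHS](bigD1 z)//= z0 cards0 expr0.
  by rewrite addrAC subrr add0r.
rewrite lerBlDr; apply: expr1D_le2.
  by rewrite !mulr_ge0// subr_ge0 ler1n.
(* For [q = 1] one cannot divide by [C], but the factor [q - 1] vanishes. *)
have [q1|q1] := ltnP 1 q; last first.
  by rewrite (_ : q%:R = 1 :> R) ?subrr ?mul0r ?mulr0 ?invr_ge0//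
    (_ : q = 1%N)//; apply/eqP; rewrite eqn_leq q1.
have C0 : 0 < C by apply: lt_le_trans (C_ge1 q1).
rewrite !mulrA ler_pdivrMr//.
have s1 := sqrt_q1_ge1 q1.
have sq : Num.sqrt (q%:R - 1 : R) ^+ 2 = q%:R - 1.
  by rewrite sqr_sqrtr// subr_ge0 ler1n.
rewrite -sq /C; set s := Num.sqrt _ in s1 sq *.
have kR : 2 <= k%:R :> R by rewrite ler_nat.
have s0 : 0 <= s := le_trans ler01 s1.
have k0 : 0 <= k%:R :> R := ler0n _ _.
(* Half of [C] is the required [k (q - 1) B] times a surplus factor, which is at least 1 because [k]
   is at least 2 and [s] and [B] are at least 1. *)
have -> : 2^-1 * (k%:R * (s * B)) ^+ 3 =
  (k%:R * s ^+ 2 * B) * ((k%:R * k%:R / 2) * (s * (B * B))).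
  by field.
rewrite ler_peMr ?mulr_ge0 ?exprn_ge0//.
have kk : 1 <= k%:R * k%:R / 2 :> R by nra.
rewrite -[X in X <= _]mulr1 ler_pM// -[X in X <= _]mulr1 ler_pM//.
by rewrite -[X in X <= _]mulr1 ler_pM.
Qed.

Let z : {ffun 'I_k -> 'I_q} := [ffun=> Ordinal q0].

Lemma column_supp_eq0 (s : {ffun 'I_k -> 'I_q}) : (column_supp s == set0) = (s == z).
Proof.
apply/eqP/eqP => [s0|->]; last by apply/setP => i; rewrite !inE ffunE.
apply/ffunP => i; apply/val_inj/eqP; rewrite ffunE /= -[_ == _]negbK.
by have := in_set0 i; rewrite -s0 inE => ->.
Qed.

Lemma column_supp_gt (r : nat) (s : {ffun 'I_k -> 'I_q}) :
  rwise_independent r mu -> s != z -> column_moment mu chi s != 0 ->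
  (r < #|column_supp s|)%N.
Proof.
move=> hr sz; apply: contraNT; rewrite -leqNgt => sr.
rewrite (column_moment0 hmu chi_basis hr)// sr andbT card_gt0.
by rewrite column_supp_eq0.
Qed.

Lemma kernel_tensor_bound (i0 : 'I_k) (n : nat)
    (a : 'I_k -> {ffun 'I_n -> 'I_q} -> R) :
  rwise_independent 2 mu -> (forall i s, 0 <= a i s) ->
  \sum_(S : {ffun 'I_n -> {ffun 'I_k -> 'I_q}})
     (\prod_j kernel (S j)) * \prod_(i | i != i0) a i [ffun j => S j i] <=
  \prod_(i | i != i0) ell2 (a i).
Proof.
move=> h2; have z0 : column_supp z = set0 by apply/eqP; rewrite column_supp_eq0.
apply: tensor_bound; first exact: kernel_ge0.
move=> b b0; apply: (column_bound (s0 := z)) => //.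
- exact: kernel_ge0.
- rewrite /kernel z0 cards0 expr0 mulr1 (column_moment1 hmu chi_basis z0).
  exact: Normc.normc1.
- exact: sum_kernel_le1.
move=> s sz ks.
have cs : column_moment mu chi s != 0.
  by apply: contraNneq ks => cs; rewrite /kernel cs Normc.normc0 mul0r.
have s3 := column_supp_gt h2 sz cs.
(* Pairwise independence leaves at least three non-zero entries, so two survive the removal of row
   [i0], as the one-column inequality demands. *)
have : (1 < #|column_supp s :\ i0|)%N.
  move: s3; rewrite (cardsD1 i0); case: (i0 \in _); first by [].
  by move/ltnW.
move=> /card_gt1P[i [j [+ + ij]]].
rewrite !inE => /andP[ii0 si] /andP[ji0 sj]; exists i, j; split=> //.
  by rewrite ffunE eq_sym -val_eqE.
by rewrite ffunE eq_sym -val_eqE.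
Qed.

Section Coefficients.
Variables (n r : nat) (f : forall i : 'I_k, {ffun 'I_n -> Omega i} -> R[i]).
Let c i s := fhat (@marginal R k Omega mu i) (@chi i) (@f i) s.
Let a i s : R := Normc.normc (c i s).
Let row (S : {ffun 'I_n -> {ffun 'I_k -> 'I_q}}) (i : 'I_k) : {ffun 'I_n -> 'I_q} :=
  [ffun j => S j i].
Let Z : {ffun 'I_n -> {ffun 'I_k -> 'I_q}} := [ffun=> z].
Let term S := (\prod_i c i (row S i)) * \prod_j column_moment mu chi (S j).

Lemma noisy_inner_sub_expansion :
  noisy_inner mu f
    - \prod_(i < k) Exp (@iid R _ (@marginal R k Omega mu i) n) (@f i) =
  \sum_(S | S != Z) term S.
Proof.
rewrite (noisy_inner_expansion chi_basis) (bigD1 Z)//= addrAC.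
rewrite [X in X - _ + _](_ : _ =
  \prod_(i < k) Exp (@iid R _ (@marginal R k Omega mu i) n) (@f i)).
  by rewrite subrr add0r.
rewrite [X in _ * X]big1 ?mulr1 => [|j _]; last first.
  rewrite (column_moment1 hmu chi_basis)//.
  by apply/eqP; rewrite column_supp_eq0 ffunE.
apply: eq_bigr => i _; rewrite (Exp_fhat0 (chi_basis i) _ (z := row Z i))//.
by move=> j; rewrite !ffunE.
Qed.

Lemma small_coefficient (delta : R) (S : {ffun 'I_n -> {ffun 'I_k -> 'I_q}}) :
  (2 <= r)%N -> rwise_independent r mu ->
  ~ large_coefficients mu chi r.+1 f delta -> S != Z -> term S != 0 ->
  exists i, a i (row S i) <= (delta / (2 * k%:R)) ^+ (2 ^ k)%N.
Proof.
move=> r2 hr nlarge SZ tS; apply: contrapT => nsmall; apply: nlarge.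
have Sj j : S j != z -> (r < #|column_supp (S j)|)%N.
  move=> Sjz; apply: column_supp_gt => //.
  by apply: contraNneq tS => Sj; rewrite /term [X in _ * X](bigD1 j)//= Sj mul0r mulr0.
have [j0 Sj0] : exists j, S j != z.
  apply/existsP; rewrite -negb_forall; apply: contraNN SZ => /eqfunP SZ.
  by apply/eqP/ffunP => j; rewrite SZ ffunE.
(* The set [I] consists of the non-zero rows of [S]. It contains the support of every column, and
   each non-zero column has more than [r] non-zero entries; this gives both cardinality bounds. *)
exists [set i | [exists j, (S j i : nat) != 0%N]], (row S); split.
- apply: leq_trans (leq_trans (Sj j0 Sj0) _); first exact: r2.
  apply/subset_leq_card/fintype.subsetP => i; rewrite !inE => Sji.
  by apply/existsP; exists j0.
- by move=> i; rewrite inE => /existsP[j Sji]; exists j; rewrite ffunE.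
- move=> i _; rewrite ltcR ltNge; apply/negP => ai.
  by apply: nsmall; exists i.
move=> j /finset.bigcupP[i _]; rewrite inE ffunE => Sji.
apply: leq_trans (Sj j _) _.
  by rewrite -column_supp_eq0; apply/set0Pn; exists i; rewrite inE.
apply/subset_leq_card/fintype.subsetP => l; rewrite !inE ffunE => Sjl.
by rewrite Sjl andbT; apply/existsP; exists j.
Qed.

(** The non-zero entries of [S] are counted by rows on one side and by columns on the other; [C]
    cancels because it is non-zero for [q > 1]. *)
Lemma prod_kernel (S : {ffun 'I_n -> {ffun 'I_k -> 'I_q}}) : (1 < q)%N ->
  \prod_j Normc.normc (column_moment mu chi (S j)) =
  C ^+ (\sum_i #|supp (row S i)|) * \prod_j kernel (S j).
Proof.
move=> q1; have C0 : C != 0 by rewrite gt_eqF// (lt_le_trans ltr01 (C_ge1 q1)).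
have -> : (\sum_i #|supp (row S i)| = \sum_j #|column_supp (S j)|)%N.
  under eq_bigr do rewrite -sum1_card big_mkcond.
  under [RHS]eq_bigr do rewrite -sum1_card big_mkcond.
  rewrite exchange_big; apply: eq_bigr => j _; apply: eq_bigr => i _.
  by rewrite !inE ffunE.
rewrite big_split /= prodrXr mulrCA exprVn mulfV ?mulr1//.
by rewrite expf_neq0.
Qed.

Let D := (\sum_(i < k) fdeg (@marginal R k Omega mu i) (@chi i) (@f i))%E.

(** In a non-zero term every row has a non-zero coefficient, so its support size is at most the
    degree of the corresponding function. *)
Lemma expr_supp_le_pow_deg (S : {ffun 'I_n -> {ffun 'I_k -> 'I_q}}) :
  (1 < q)%N -> term S != 0 ->
  C ^+ (\sum_i #|supp (row S i)|) <= pow_deg C D.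
Proof.
move=> q1; rewrite mulf_eq0 negb_or => /andP[/prodf_neq0 cS _].
apply: expr_le_pow_deg; first exact: C_ge1.
  by rewrite natr_sum -sumEFin; apply: lee_sum => i _; apply/fdeg_ge/cS.
apply: (@le_lt_trans _ _ (\sum_(i < k) (n%:R)%:E)%E).
  by apply: lee_sum => i _; exact: fdeg_le.
by rewrite sumEFin ltry.
Qed.

Lemma large_coefficients_rwise (delta : R) :
  (2 <= r)%N -> rwise_independent r mu ->
  (forall i, norm2 (@iid R _ (@marginal R k Omega mu i) n) (@f i) <= 1) ->
  0 < delta ->
  (pow_deg C D * delta)%:C <
    `|noisy_inner mu f
      - \prod_(i < k) Exp (@iid R _ (@marginal R k Omega mu i) n) (@f i)| ->
  large_coefficients mu chi r.+1 f delta.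
Proof.
move=> r2 hr f1 delta0 large; apply: contrapT => nlarge.
have h2 : rwise_independent 2 mu by move=> J J2; apply: hr; apply: leq_trans r2.
have P0 := pow_deg_ge0 C D; set P := pow_deg C D in large P0.
have k0 : 0 < k%:R :> R by rewrite ltr0n (ltn_trans _ k2).
have a0 i s : 0 <= a i s by apply: normc_ge0.
have a1 i : ell2 (a i) <= 1 by apply: (ell2_fhat_le1 (chi_basis i)).
pose eps := delta / (2 * k%:R).
have eps0 : 0 < eps by rewrite divr_gt0// mulr_gt0.
(* If [eps] exceeds 1, the bound comes from the coefficient being at most 1 by Parseval. *)
have a_le_eps i s : a i s <= eps ^+ (2 ^ k)%N -> a i s <= eps.
  move=> asmall; have [e1|e1] := lerP eps 1.
    by apply: le_trans asmall _; rewrite ler_iXnr ?expn_gt0// ltW.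
  by apply: le_trans (ltW e1); apply: le_trans (a1 i); apply: le_ell2.
pose bound (S : {ffun 'I_n -> {ffun 'I_k -> 'I_q}}) i0 :=
  (\prod_j kernel (S j)) * \prod_(i | i != i0) a i (row S i).
have bound0 S i0 : 0 <= bound S i0.
  by apply: mulr_ge0; apply: prodr_ge0 => *; [exact: kernel_ge0 | exact: a0].
have Peps0 : 0 <= P * eps by apply: mulr_ge0 => //; exact: ltW.
(* The row with a small coefficient depends on [S]; summing the non-negative bounds over all [i0]
   removes this dependence at the price of a factor [k]. *)
have term_le S : S != Z ->
    Normc.normc (term S) <= \sum_i0 P * eps * bound S i0.
  move=> SZ; have [->|tS] := eqVneq (term S) 0.
    rewrite Normc.normc0; apply: sumr_ge0 => i0 _.
    exact: mulr_ge0.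
  have q1 : (1 < q)%N.
    rewrite ltnNge; apply: contraNN SZ => q1; apply/eqP/ffunP => j.
    apply/ffunP => i; apply/val_inj; rewrite !ffunE /=.
    by apply/eqP; rewrite -leqn0 -ltnS (leq_trans (ltn_ord _) q1).
  have [i0 ai0] := small_coefficient r2 hr nlarge SZ tS.
  rewrite (bigD1 i0)//= -[X in X <= _]addr0 lerD//; last first.
    by apply: sumr_ge0 => i _; exact: mulr_ge0.
  rewrite Normc.normcM !normc_prod prod_kernel// (bigD1 i0)//=.
  rewrite -/(a i0 (row S i0)).
  set A := \prod_(i | _) _; set K := \prod_j _; set M := _ ^+ _.
  have -> : a i0 (row S i0) * A * (M * K) = M * a i0 (row S i0) * (K * A).
    by ring.
  apply: ler_wpM2r; first exact: bound0.
  apply: ler_pM => //; first by rewrite exprn_ge0// C_ge0.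
    exact: expr_supp_le_pow_deg.
  exact: a_le_eps.
(* The right-hand side equals [P * delta / 2], so this strict inequality is absurd, also when
   [P = 0]. *)
have : P * delta < P * eps * k%:R.
  rewrite -ltcR; apply: (lt_le_trans large).
  rewrite noisy_inner_sub_expansion.
  apply: (le_trans (ler_norm_sum _ _ _)).
  apply: (@le_trans _ _ (\sum_(S | S != Z) (\sum_i0 P * eps * bound S i0)%:C)).
    by apply: ler_sum => S SZ; rewrite lecR term_le.
  rewrite -rmorph_sum lecR.
  apply: (@le_trans _ _ (\sum_S \sum_i0 P * eps * bound S i0)).
    (* The non-negative bound at [Z] is added back, since the tensorized inequality sums over all
       matrices. *)
    rewrite [leRHS](bigD1 Z)//= lerDr; apply: sumr_ge0 => i0 _.
    exact: mulr_ge0.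
  rewrite exchange_big /=.
  apply: (@le_trans _ _ (\sum_(i0 < k) P * eps)); last first.
    by rewrite sumr_const card_ord mulr_natr.
  apply: ler_sum => i0 _; rewrite -mulr_sumr ler_piMr//.
  apply: le_trans (kernel_tensor_bound i0 h2 a0) _.
  by apply: prodr_ile1 => i _; rewrite ell2_ge0 a1.
apply/negP; rewrite -leNgt.
have -> : P * eps * k%:R = P * delta / 2.
  by rewrite /eps; field; rewrite gt_eqF.
have := mulr_ge0 P0 (ltW delta0); lra.
Qed.

End Coefficients.

Lemma inverse_theorem_bounded_basis :
  pairwise_independent mu -> inverse_theorem mu chi C.
Proof.
move=> hpair n f f1 /= delta delta0 large; split.
  exact: (large_coefficients_rwise (leqnn 2) (rwise_independent2 hmu hpair) f1).
move=> r r2 hr; exact: (large_coefficients_rwise r2 hr f1).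
Qed.

End Inverse.

(** * Bounding an arbitrary Fourier basis by the smallest atom *)

Section Atoms.
Variables (R : realType) (k : nat) (Omega : 'I_k -> finType).
Variable mu : {dffun forall i, Omega i} -> R.

Lemma alpha_le1 : alpha mu <= 1.
Proof. exact: bigmin_le_id. Qed.

Lemma alpha_le_marginal (i : 'I_k) (a : Omega i) :
  0 < marginal mu a -> alpha mu <= marginal mu a.
Proof.
move=> a0; apply: (@bigmin_inf _ _ _ _ i) => //.
by apply: (@bigmin_inf _ _ _ _ a) => //; rewrite gt_eqF.
Qed.

Lemma alpha_gt0 : (forall i (a : Omega i), 0 < marginal mu a) -> 0 < alpha mu.
Proof.
move=> hpos; apply: lt_bigmin => // i _.
by apply: lt_bigmin => // a _.
Qed.

End Atoms.

(** In the identity stating that [chi s] has norm 1, the single point [x] already contributes at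
    least [alpha] times the squared modulus of [chi s x]. *)
Lemma fourier_basis_bound (R : realType) (q : nat) (T : finType) (p : T -> R)
    (chi : 'I_q -> T -> R[i]) (alpha : R) (s : 'I_q) (x : T) :
  is_fourier_basis p chi -> 0 < alpha -> (forall y, alpha <= p y) ->
  Normc.normc (chi s x) <= Num.sqrt alpha^-1.
Proof.
move=> [_ orth _] alpha0 palpha.
have p0 y : 0 <= p y by apply: le_trans (palpha y); apply: ltW.
have sum1 : \sum_y p y * Normc.normc (chi s y) ^+ 2 = 1.
  apply: (@complexI R); rewrite rmorph_sum.
  transitivity (inner p (chi s) (chi s)); last by rewrite orth eqxx.
  by apply: eq_bigr => y _; rewrite rmorphM rmorphXn -normCK.
have le1 : alpha * Normc.normc (chi s x) ^+ 2 <= 1.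
  rewrite -sum1 (bigD1 x)//= -[X in X <= _]addr0 lerD//.
    by rewrite ler_wpM2r// sqr_ge0.
  by apply: sumr_ge0 => y _; rewrite mulr_ge0// sqr_ge0.
rewrite -(ger0_norm (normc_ge0 (chi s x))) -sqrtr_sqr ler_wsqrtr//.
by rewrite -[alpha^-1]mul1r ler_pdivlMr// mulrC.
Qed.

(** * Roots of unity and the character basis for uniform marginals *)

Lemma prim_root_exists (F : closedFieldType) (n : nat) :
  n%:R != 0 :> F -> exists w : F, n.-primitive_root w.
Proof.
move=> nF; have n_gt0 : (0 < n)%N by case: n nF => //; rewrite eqxx.
(* This polynomial splits and is separable, so it has [n] distinct roots; that many roots of unity
   of order dividing [n] include a primitive one. *)
pose p : {poly F} := 'X^n - 1; have [r Dp] := closed_field_poly_normal p.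
rewrite (monicP _) ?monicXnsubC // scale1r in Dp.
have rn1 : all n.-unity_root r by apply/allP => w; rewrite -root_prod_XsubC -Dp.
have sz_r : (n < (size r).+1)%N.
  by rewrite -(size_prod_XsubC r id) -Dp size_XnsubC.
have [|w _ wP] := hasP (has_prim_root n_gt0 rn1 _ sz_r); last by exists w.
by rewrite -separable_prod_XsubC -Dp separable_Xn_sub_1.
Qed.

Section Characters.
Variables (R : realType) (q : nat) (w : R[i]).
Hypotheses (q0 : (0 < q)%N) (w_prim : q.-primitive_root w).

Lemma norm_prim_root : `|w| = 1.
Proof.
apply/eqP; rewrite -(@pexpr_eq1 _ _ q)// -normrX (prim_expr_order w_prim).
by rewrite normr1.
Qed.

Lemma mul_conj_expr (b : nat) : w ^+ b * (w ^+ b)^*%R = 1.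
Proof. by rewrite -normCK normrX norm_prim_root !expr1n. Qed.

(** A geometric sum: for [a] different from [b] the ratio is not 1, but its [q]-th power is. *)
Lemma sum_prim_root (a b : 'I_q) :
  \sum_(j < q) (w ^+ a * (w ^+ b)^*%R) ^+ j = q%:R * (a == b)%:R.
Proof.
have [->|ab] := eqVneq a b.
  rewrite mul_conj_expr mulr1; under eq_bigr do rewrite expr1n.
  by rewrite sumr_const card_ord.
set u := _ * _; rewrite mulr0.
have u1 : u - 1 != 0.
  rewrite subr_eq0; apply: contraNneq ab => u1.
  have : w ^+ a = w ^+ b.
    by rewrite -[LHS]mulr1 -(mul_conj_expr b) [X in _ * X]mulrC mulrA -/u u1 mul1r.
  by move/eqP; rewrite (eq_prim_root_expr w_prim) !modn_small.
apply: (mulfI u1); rewrite mulr0 -subrX1 /u exprMn -rmorphXn -!exprM.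
rewrite ![(_ * q)%N]mulnC !exprM (prim_expr_order w_prim) !expr1n.
by rewrite rmorph1 mulr1 subrr.
Qed.

Variables (T : finType) (cardT : #|T| = q).

(** The characters of the cyclic group of order [q], carried to [T] by its enumeration. Having
    modulus 1, they allow [B = 1]. *)
Definition root_character (s : 'I_q) (x : T) : R[i] :=
  w ^+ (s * enum_rank x).

Lemma normc_root_character (s : 'I_q) (x : T) :
  Normc.normc (root_character s x) = 1.
Proof.
apply: (@complexI R).
by rewrite -[LHS]/(`|root_character s x|) normrX norm_prim_root expr1n.
Qed.

Let rk (x : T) : 'I_q := cast_ord cardT (enum_rank x).

Let rk_bij : bijective rk.
Proof.
exists (fun j => enum_val (cast_ord (esym cardT) j)) => x.
  by rewrite /rk cast_ordK enum_rankK.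
by rewrite /rk enum_valK cast_ordKV.
Qed.

Lemma root_character_basis (p : T -> R) :
  uniform p -> is_fourier_basis p root_character.
Proof.
move=> unif; have qC : q%:R != 0 :> R[i] by rewrite pnatr_eq0 -lt0n.
have pE x : (p x)%:C = q%:R^-1 :> R[i] by rewrite unif cardT fmorphV rmorph_nat.
split=> [s s0 x|s t|f].
- by rewrite /root_character s0 mul0n expr0.
- transitivity (\sum_x q%:R^-1 * (w ^+ s * (w ^+ t)^*%R) ^+ rk x).
    apply: eq_bigr => x _; rewrite pE /root_character !exprM exprMn.
    by rewrite rmorphXn.
  rewrite -mulr_sumr.
  have -> : \sum_x (w ^+ s * (w ^+ t)^*%R) ^+ rk x =
      \sum_(j < q) (w ^+ s * (w ^+ t)^*%R) ^+ j.
    by rewrite [RHS](reindex rk)//; exact: onW_bij.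
  by rewrite sum_prim_root mulrA mulVf// mul1r.
(* Inverse discrete Fourier transform: the same orthogonality relation is used with points and
   characters exchanged. *)
exists (fun s => q%:R^-1 * \sum_y f y * (root_character s y)^*%R) => x.
transitivity (\sum_y q%:R^-1 * f y *
    \sum_(s < q) (w ^+ rk x * (w ^+ rk y)^*%R) ^+ s).
  under eq_bigr do rewrite sum_prim_root (inj_eq (bij_inj rk_bij)).
  rewrite (bigD1 x)//= [X in _ + X]big1 ?addr0.
    by rewrite eqxx mulr1 mulrAC mulVf// mul1r.
  by move=> y yx; rewrite eq_sym (negPf yx) !mulr0.
under eq_bigr do rewrite mulr_sumr.
rewrite exchange_big; apply: eq_bigr => s _ /=.
rewrite mulr_sumr mulr_suml; apply: eq_bigr => y _.
rewrite /root_character exprMn -rmorphXn -!exprM ![(_ * s)%N]mulnC.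
by rewrite -!mulrA; congr (_ * (_ * _)); rewrite mulrC.
Qed.

End Characters.

Unset Implicit Arguments.

Theorem corollary3p8 (R : realType) (k q : nat) (Omega : 'I_k -> finType)
    (mu : {dffun forall i : 'I_k, Omega i} -> R)
    (hk : (2 <= k)%N) (hq : (1 <= q)%N)
    (hOmega : forall i : 'I_k, #|Omega i| = q)
    (hmu : is_distribution mu)
    (hpair : pairwise_independent mu)
    (hpos : forall (i : 'I_k) (a : Omega i), 0 < marginal mu a) :
  (forall chi : forall i : 'I_k, 'I_q -> Omega i -> R[i],
     (forall i : 'I_k, is_fourier_basis (@marginal R k Omega mu i) (chi i)) ->
     inverse_theorem mu chi
       ((k%:R * Num.sqrt ((q%:R - 1) / alpha mu)) ^+ 3)) /\
  ((forall i : 'I_k, uniform (@marginal R k Omega mu i)) ->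
   exists chi : forall i : 'I_k, 'I_q -> Omega i -> R[i],
     (forall i : 'I_k, is_fourier_basis (@marginal R k Omega mu i) (chi i)) /\
     inverse_theorem mu chi ((k%:R * Num.sqrt (q%:R - 1)) ^+ 3)).
Proof.
have q1 : 0 <= q%:R - 1 :> R by rewrite subr_ge0 ler1n.
split=> [chi chi_basis|unif].
  have a0 := alpha_gt0 hpos.
  (* Isolates the bound [B], here the square root of [1 / alpha]; it is at least 1 because [alpha]
     is at most 1. *)
  rewrite (sqrtrM _ q1).
  apply: inverse_theorem_bounded_basis => // [|i t x].
    by rewrite -[X in X <= _]sqrtr1 ler_wsqrtr// invf_ge1// alpha_le1.
  apply: (fourier_basis_bound _ _ (chi_basis i) a0) => y.
  exact: alpha_le_marginal.
have [w w_prim] : exists w : R[i], q.-primitive_root w.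
  by apply: prim_root_exists; rewrite pnatr_eq0 -lt0n.
pose chi i := root_character w (q := q) (T := Omega i).
have chi_basis i : is_fourier_basis (@marginal R k Omega mu i) (chi i).
  exact: root_character_basis.
exists chi; split=> //; rewrite -[Num.sqrt _]mulr1.
apply: inverse_theorem_bounded_basis => // i t x.
by rewrite normc_root_character.
Qed.
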